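(* Let $\mathbb F$ be a field with at least $3$ elements, let $X$ be a nonempty set, and let $A\subseteq\mathbb F^X$ be a function algebra that is a GKŻ algebra. Then $A$ is generated by units.
   Context: A function algebra over $\mathbb F$ on a nonempty set $X$ is a subalgebra $A$ of the $\mathbb F$-algebra $\mathbb F^X$ of all functions $X\to\mathbb F$ (pointwise operations) containing the constant function $1$. $\mathcal U(A)$ denotes the group of units of $A$ (elements having an inverse in $A$). A unital algebra $A$ over $\mathbb F$ is a GKŻ algebra if every linear functional $\Lambda:A\to\mathbb F$ such that $\Lambda(u)\neq0$ for all $u\in\mathcal U(A)$ and $\Lambda(\mathbf 1_A)=1$ is multiplicative. $A$ is generated by units if $A=\operatorname{span}_{\mathbb F}(\mathcal U(A))$; equivalently, every element of $A$ is a finite sum of units. *)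

(* Defs.v *)
From HB Require Import structures.
From mathcomp Require Import all_boot all_algebra.
From mathcomp Require Import boolp classical_sets functions.

Set Implicit Arguments.
Unset Strict Implicit.
Unset Printing Implicit Defensive.

Import GRing.Theory.
Local Open Scope ring_scope.

(* A nonempty set is a pointedType: X -> V is then a nontrivial ring, as the  *)
(* hierarchy of algebras requires. The F-algebra of functions from X to F is  *)
(* X -> F^o, where F^o is F seen as an algebra over itself.                   *)
Section FunctionAlgebra.
Variables (R : nzRingType) (X : pointedType) (V : algType R).

Fact fct_scalerAl (k : R) (f g : X -> V) : k *: (f * g) = (k *: f) * g.
Proof. by apply/funext => x; exact: scalerAl. Qed.

HB.instance Definition _ :=
  GRing.Lmodule_isLalgebra.Build R (X -> V) fct_scalerAl.

Fact fct_scalerAr (k : R) (f g : X -> V) : k *: (f * g) = f * (k *: g).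
Proof. by apply/funext => x; exact: scalerAr. Qed.

HB.instance Definition _ :=
  GRing.Lalgebra_isAlgebra.Build R (X -> V) fct_scalerAr.

End FunctionAlgebra.

(* A subalgebra, regarded as an algebra in its own right. *)
Definition subalg (R : nzRingType) (V : algType R) (A : subalgClosed V) :=
  {f : V | f \in A}.

HB.instance Definition _ (R : nzRingType) (V : algType R) (A : subalgClosed V) :=
  SubChoice.on (subalg A).
HB.instance Definition _ (R : nzRingType) (V : algType R) (A : subalgClosed V) :=
  [SubChoice_isSubAlgebra of subalg A by <:].

(* GRing.unit is not used: it belongs to unitRingType, a structure that an    *)
(* arbitrary algebra does not carry.                                          *)
Definition is_unit (A : nzRingType) (u : A) : Prop :=
  exists v : A, u * v = 1 /\ v * u = 1.

Definition GKZ_algebra (F : fieldType) (A : algType F) : Prop :=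
  forall L : {scalar A},
    (forall u : A, is_unit u -> L u <> 0) -> L 1 = 1 ->
    {morph L : a b / a * b}.

Definition generated_by_units (F : fieldType) (A : algType F) : Prop :=
  forall a : A, exists (n : nat) (c : 'I_n -> F) (u : 'I_n -> A),
    (forall i, is_unit (u i)) /\ a = \sum_(i < n) c i *: u i.

(* Main.v *)
(* If [a] is not in the span of the units, some functional [M] vanishes on    *)
(* that span and takes the value 1 at [a]. Evaluation at a point [x] plus     *)
(* [k *: M] does not vanish on units and maps 1 to 1, so it is multiplicative *)
(* for every scalar [k]. Comparing its values at [a ^ 2] and [a] gives        *)
(* [k M(a^2) = 2 k a(x) + k^2], which has at most one solution [k <> 0],      *)
(* whereas a field with three elements has two nonzero scalars.               *)
Require Import Defs.
From HB Require Import structures.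
From mathcomp Require Import all_boot all_algebra.
From mathcomp Require Import boolp classical_sets functions.
From mathcomp Require Import ring.

Set Implicit Arguments.
Unset Strict Implicit.
Unset Printing Implicit Defensive.

Local Open Scope ring_scope.
Import GRing.Theory.
Local Open Scope classical_set_scope.

(** The functional [M] comes from [exists_separating_scalar]: a subspace maximal among those
    avoiding [a] is a complement of the line through [a], and [M] is the coordinate along [a]. The
    comparison of values is made in [generated_by_units_of_character], for any algebra with a
    multiplicative functional [e] such that [e 1 = 1]; evaluation at a point provides [e]. *)

Definition subspace (F : fieldType) (V : lmodType F) (U : set V) :=
  U 0 /\ forall (k : F) x y, U x -> U y -> U (k *: x + y).

Lemma subspaceZ (F : fieldType) (V : lmodType F) (U : set V) (k : F) x :
  subspace U -> U x -> U (k *: x).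
Proof. by case=> U0 UL Ux; rewrite -[_ *: _]addr0; exact: UL. Qed.

Lemma subspaceB (F : fieldType) (V : lmodType F) (U : set V) x y :
  subspace U -> U x -> U y -> U (x - y).
Proof. by case=> _ UL Ux Uy; rewrite addrC -scaleN1r; exact: UL. Qed.

Lemma exists_maximal_subspace_avoiding (F : fieldType) (V : lmodType F)
    (U : set V) (a : V) : subspace U -> ~ U a ->
  exists H : set V, [/\ subspace H, U `<=` H, ~ H a &
    forall B, subspace B -> H `<=` B -> ~ B a -> B `<=` H].
Proof.
move=> sU Ua.
(* The empty set satisfies [P], as the empty chain requires. *)
pose P (B : set V) := [/\ forall (k : F) x y, B x -> B y -> B (k *: x + y),
  forall x y, B x -> U y -> B (x + y) & ~ B a].
have subspaceP B : subspace B -> U `<=` B -> ~ B a -> P B.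
  move=> [B0 BL] UB Ba; split=> // x y Bx /UB By.
  by rewrite -[x]scale1r; exact: BL.
have [C CP Ctot|H [[HL HU Ha] Hmax]] := @Zorn_bigcup V P.
  split.
  - move=> k x y [B1 C1 B1x] [B2 C2 B2y].
    have [B12|B21] := Ctot _ _ C1 C2.
    + by exists B2 => //; case: (CP _ C2) => BL _ _; apply: BL => //; exact: B12.
    + by exists B1 => //; case: (CP _ C1) => BL _ _; apply: BL => //; exact: B21.
  - move=> x y [B CB Bx] Uy; exists B => //.
    by case: (CP _ CB) => _ BU _; exact: BU.
  - by move=> [B CB Ba]; case: (CP _ CB).
have maxH B : P B -> H `<=` B -> B `<=` H.
  by move=> PB HB; apply: contrapT => nBH; exact: (Hmax B).
(* An empty [H] would not be maximal, since [U] satisfies [P] and contains 0. *)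
have [h Hh] : exists h, H h.
  apply: contrapT => H0; apply: (H0); exists 0.
  apply: (maxH U); [exact: subspaceP| |by case: sU].
  by move=> x Hx; case: H0; exists x.
have H0 : H 0 by rewrite -[0](addNr h) -scaleN1r; exact: HL.
have sH : subspace H by [].
have UH : U `<=` H by move=> x Ux; rewrite -[x]add0r; exact: HU.
exists H; split=> // B sB HB Ba; apply: maxH => //.
by apply: subspaceP => // x /UH /HB.
Qed.

Lemma scalar_of_linear (F : fieldType) (V : lmodType F) (f : V -> F) :
  (forall k x y, f (k *: x + y) = k * f x + f y) ->
  exists L : {scalar V}, L =1 f.
Proof.
move=> fL.
pose fM := GRing.isLinear.Build F V F *%R f fL.
pose L : {scalar V} := HB.pack f fM.
by exists L.
Qed.

Lemma exists_separating_scalar (F : fieldType) (V : lmodType F)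
    (U : set V) (a : V) : subspace U -> ~ U a ->
  exists M : {scalar V}, (forall x, U x -> M x = 0) /\ M a = 1.
Proof.
move=> sU Ua.
have [H [sH UH Ha Hmax]] := exists_maximal_subspace_avoiding sU Ua.
(* If [v] is outside [H], then [H] extended by [v] must contain [a] by maximality: [a = h + k *: v].
   Here [k] is nonzero because [a] is not in [H], so one can solve for [v]. *)
have coord_ex v : exists c : F, H (v - c *: a).
  have [Hv|Hv] := pselect (H v); first by exists 0; rewrite scale0r subr0.
  pose B := [set x | exists h k, H h /\ x = h + k *: v].
  have HB : H `<=` B by move=> x Hx; exists x, 0; rewrite scale0r addr0.
  have sB : subspace B.
    split=> [|k _ _ [h1 [k1 [Hh1 ->]]] [h2 [k2 [Hh2 ->]]]].
      by apply: HB; case: sH.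
    exists (k *: h1 + h2), (k * k1 + k2); split; first by case: sH => _; apply.
    by rewrite scalerDr scalerDl scalerA addrACA.
  have [h [k [Hh aE]]] : B a.
    apply: contrapT => Ba; apply/Hv/(Hmax B) => //.
    by exists 0, 1; split; [case: sH|rewrite add0r scale1r].
  have k0 : k != 0.
    by apply: contra_notN Ha => /eqP k0; rewrite aE k0 scale0r addr0.
  exists k^-1; rewrite aE scalerDr scalerA mulVf // scale1r opprD addrCA subrr.
  by rewrite addr0 -scaleNr; exact: subspaceZ.
(* Two distinct coordinates would put a nonzero multiple of [a], hence [a], in [H]. *)
have coord_uniq v (c d : F) : H (v - c *: a) -> H (v - d *: a) -> c = d.
  move=> Hc Hd; apply/eqP; rewrite -subr_eq0; apply: contra_notT Ha => cd0.
  rewrite -[a]scale1r -(mulVf cd0) -scalerA; apply: subspaceZ => //.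
  have -> : (c - d) *: a = (v - d *: a) - (v - c *: a).
    by rewrite scalerBl opprB [RHS]addrC addrA subrK.
  exact: subspaceB.
have [f fP] := choice coord_ex.
(* The chosen coordinate is linear because coordinates are unique. *)
have [|M ME] := @scalar_of_linear F V f.
  move=> k x y; apply: coord_uniq (fP _) _.
  have -> : k *: x + y - (k * f x + f y) *: a
      = k *: (x - f x *: a) + (y - f y *: a).
    by rewrite scalerBr scalerA scalerDl opprD addrACA.
  by case: sH => _; apply.
have H0 : H 0 by case: sH.
exists M; split=> [x /UH Hx|]; rewrite ME; apply: coord_uniq (fP _) _.
  by rewrite scale0r subr0.
by rewrite scale1r subrr.
Qed.

(** The condition repeats the body of [generated_by_units], so that [generated_by_units A] is by
    conversion membership of every element. *)
Definition unit_span (F : fieldType) (A : algType F) : set A :=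
  [set a | exists (n : nat) (c : 'I_n -> F) (u : 'I_n -> A),
    (forall i, is_unit (u i)) /\ a = \sum_(i < n) c i *: u i].

Lemma subspace_unit_span (F : fieldType) (A : algType F) :
  subspace (@unit_span F A).
Proof.
split=> [|k _ _ [n [c [u [uU ->]]]] [m [d [v [vU ->]]]]].
  by exists 0%N, (fun=> 0), (fun=> 0); split=> [[]|] //; rewrite big_ord0.
exists (n + m)%N,
  (fun i => match fintype.split i with inl j => k * c j | inr j => d j end),
  (fun i => match fintype.split i with inl j => u j | inr j => v j end).
split=> [i|]; first by case: (fintype.split i).
rewrite big_split_ord scaler_sumr; congr (_ + _); apply: eq_bigr => i _.
  by rewrite (unsplitK (inl i)) scalerA.
by rewrite (unsplitK (inr i)).
Qed.

Lemma unit_span_unit (F : fieldType) (A : algType F) (u : A) :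
  is_unit u -> unit_span u.
Proof.
move=> uU; exists 1%N, (fun=> 1), (fun=> u); split=> //.
by rewrite big_ord1 scale1r.
Qed.

Lemma is_unit1 (A : nzRingType) : is_unit (1 : A).
Proof. by exists 1; rewrite mulr1. Qed.

Lemma generated_by_units_of_character (F : fieldType) (A : algType F)
    (e : {scalar A}) :
  (exists a b c : F, uniq [:: a; b; c]) ->
  e 1 = 1 -> {morph e : a b / a * b} ->
  GKZ_algebra A -> generated_by_units A.
Proof.
move=> F_ge3 e1 eM gkz a; apply: contrapT => aS.
have [M [MS Ma]] := exists_separating_scalar (@subspace_unit_span _ _) aS.
have MU u : is_unit u -> M u = 0 by move=> /unit_span_unit /MS.
have keyE k : k != 0 -> k = M (a * a) - 2 * e a.
  move=> k0.
  have [|L LE] := @scalar_of_linear F A (fun f => e f + k * M f).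
    by move=> l f g; rewrite !linearP /=; ring.
  have Lmul : {morph L : f g / f * g}.
    (* On units [M] vanishes, so [L] agrees there with [e], and [e u * e v = 1] when [v] is the
       inverse of [u]. *)
    apply: gkz => [u uU|]; rewrite LE MU ?mulr0 ?addr0 //; last exact: is_unit1.
    case: uU => v [uv _] eu0; have := eM u v.
    by rewrite uv e1 eu0 mul0r => /eqP; rewrite oner_eq0.
  have := Lmul a a; rewrite !LE eM Ma mulr1 => LaE.
  apply: (mulfI k0); rewrite mulrBr.
  have -> : k * M (a * a) = (e a + k) * (e a + k) - e a * e a.
    by rewrite -LaE addrC addKr.
  by ring.
have [b [c [d]]] := F_ge3.
rewrite /= !inE negb_or andbT => /andP[/andP[bc bd] cd].
(* The nonzero scalars [c - b] and [d - b] both equal the value given by [keyE], which forces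
   [c = d]. *)
have := keyE (c - b); rewrite subr_eq0 eq_sym => /(_ bc).
have := keyE (d - b); rewrite subr_eq0 eq_sym => /(_ bd) <- /addIr cdE.
by rewrite cdE eqxx in cd.
Qed.

Theorem corollary2p2 (F : fieldType)
    (F_ge3 : exists a b c : F, uniq [:: a; b; c])
    (X : pointedType) (A : subalgClosed (X -> F^o)) :
  GKZ_algebra (subalg A) -> generated_by_units (subalg A).
Proof.
(* The multiplicative functional is evaluation at [point], the distinguished element of the nonempty
   set [X]. *)
have [k f g|e eE] :=
  @scalar_of_linear F (subalg A) (fun f => (val f : X -> F^o) point).
  by rewrite linearP.
have e1 : e 1 = 1 by rewrite eE rmorph1.
have eM : {morph e : f g / f * g} by move=> f g; rewrite !eE rmorphM.
exact: generated_by_units_of_character F_ge3 e1 eM.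
Qed.
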